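(* Let $d\ge 1$ be an integer. For positive integers $k$ define $A_d(k)=k$ if $k\leq d+1$ and $A_d(k)=d\binom{k-1}{d}+1$ if $k>d+1$, and define $B_d(k)=k(A_d(k)-1)+1$. Let $F=\{X_1,\dots,X_m\}$ be a family of finite sets in $\mathbb{R}^d$. If \[\varphi\Big(\bigcup_{i\in I}X_i\Big)\geq B_d(|I|)\] for every non-empty subset $I\subset\{1,\dots,m\}$, then $F$ has a system of general position representatives.
   Context: A subset $X\subset\mathbb{R}^d$ is in general position if every subset of $X$ of size at most $d+1$ is affinely independent. For a finite set $X\subset\mathbb{R}^d$, $\varphi(X)$ denotes the maximal size of a subset of $X$ in general position. A system of general position representatives of $F=\{X_1,\dots,X_m\}$ is a set $\{x_1,\dots,x_m\}$ in general position with $x_i\in X_i$ for all $i$. *)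

(* Defs.v *)
From HB Require Import structures.
From mathcomp Require Export all_boot all_order all_algebra finmap.
From mathcomp Require Export boolp classical_sets reals.

Set Implicit Arguments.
Unset Strict Implicit.
Unset Printing Implicit Defensive.

Import GRing.Theory Num.Theory.

Local Open Scope fset_scope.
Local Open Scope classical_set_scope.
Local Open Scope ring_scope.

Section GeneralPosition.
Variables (R : realType) (d : nat).
Implicit Types (S X Y : {fset 'rV[R]_d}).

Definition affinely_independent S : Prop :=
  forall c : 'rV[R]_d -> R,
    \sum_(x <- S) c x = 0 -> \sum_(x <- S) c x *: x = 0 ->
    forall x, x \in S -> c x = 0.

Definition general_position (X : set 'rV[R]_d) : Prop :=
  forall S, [set` S] `<=` X -> (#|` S| <= d.+1)%N -> affinely_independent S.

Definition phi X : nat :=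
  (\max_(Y <- fpowerset X | `[< general_position [set` Y] >]) #|` Y|)%N.

(* Injectivity of [x] expresses that the representatives x_1, ..., x_m are m
   distinct points, as for systems of distinct representatives; without it the
   set {x_1, ..., x_m} could collapse to fewer points. *)
Definition is_gp_representatives m (X : 'I_m -> {fset 'rV[R]_d})
    (x : 'I_m -> 'rV[R]_d) : Prop :=
  [/\ injective x, forall i, x i \in X i & general_position (range x)].

Definition has_gp_representatives m (X : 'I_m -> {fset 'rV[R]_d}) : Prop :=
  exists x, is_gp_representatives X x.

End GeneralPosition.

Definition gpA (d k : nat) : nat :=
  if (k <= d.+1)%N then k else (d * 'C(k.-1, d)).+1.

(* gpA d k > 0 for k > 0, so the predecessor is the true A_d(k) - 1. *)
Definition gpB (d k : nat) : nat := (k * (gpA d k).-1).+1.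

(* Main.v *)
(** By pigeonhole, [B_d(k)] points in general position inside a union of [k]
sets leave [A_d(k)] of them in a single set. Removing such a set and iterating
orders the family so that the [k]-th set contains [A_d(k)] points in general
position. Representatives are then chosen greedily in that order: with
[t = min(d, k - 1)], the [k - 1] points already chosen span ['C(k - 1, t)]
flats generated by [t] points, each of which contains at most [t] points of a
set in general position, and [A_d(k) = t * 'C(k - 1, t) + 1]. *)
Require Import Defs.

Set Implicit Arguments.
Unset Strict Implicit.
Unset Printing Implicit Defensive.

Import GRing.Theory Num.Theory.
Local Open Scope fset_scope.
Local Open Scope ring_scope.

(** * Finite counting *)

Lemma gpA_minn d k :
  gpA d k.+1 = (minn d k * 'C(k, minn d k)).+1.
Proof.
rewrite /gpA /= ltnS; case: leqP => // _.
(* Only [k <= d] is left: the minimum is [k] and the binomial is 1. *)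
by rewrite binn muln1.
Qed.

(** This union bound serves twice: for the forbidden points on flats and for the pigeonhole over the
    family. *)
Lemma card_le_sum_cover (K : choiceType) (I : finType) (P : pred I)
    (Y : {fset K}) (G : I -> {fset K}) :
  (forall y, y \in Y -> exists2 i, P i & y \in G i) ->
  (#|` Y| <= \sum_(i | P i) #|` G i|)%N.
Proof.
move=> YG; apply: (@leq_trans #|` \bigcup_(i | P i) G i|).
  apply: fsubset_leq_card; apply/fsubsetP => y /YG [i Pi yi].
  by apply/bigfcupP; exists i => //; rewrite mem_index_enum.
elim/big_rec2: _ => [|i n B _ IH]; first by rewrite cardfs0.
by rewrite (leq_trans (leq_of_leqif (leq_card_fsetU _ _))) // leq_add2l.
Qed.

Lemma subset_card_between (I : finType) (A B : {set I}) n :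
  A \subset B -> (#|A| <= n <= #|B|)%N ->
  exists C : {set I}, [/\ A \subset C, C \subset B & #|C| = n].
Proof.
move=> AB /andP[An nB].
have /card_geqP[s [us ss sBA]] : (n - #|A| <= #|B :\: A|)%N.
  by rewrite cardsD (finset.setIidPr AB) leq_sub2r.
exists (A :|: [set i in s]); split; first exact: finset.subsetUl.
  rewrite finset.subUset AB; apply/fintype.subsetP => i; rewrite inE => /sBA.
  by rewrite inE => /andP[].
have A0 : A :&: [set i in s] = finset.set0.
  apply/setP => i; rewrite !inE; apply/negP => /andP[iA /sBA].
  by rewrite inE iA.
by rewrite cardsU A0 cards0 subn0 cardsE (card_uniqP us) ss subnKC.
Qed.

Section GeneralPositionFamilies.
Variables (R : realType) (d : nat).
Local Notation point := 'rV[R]_d.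

Lemma phi_witness (X : {fset point}) :
  exists Y : {fset point},
    [/\ Y `<=` X, general_position [set` Y]%classic & #|` Y| = phi X].
Proof.
rewrite /phi big_seq_cond; apply: (big_ind (fun n => exists Y : {fset point},
    [/\ Y `<=` X, general_position [set` Y]%classic & #|` Y| = n])).
(* The maximum starts from 0, so this value needs a witness too. *)
- exists fset0; split; rewrite ?fsub0set ?cardfs0 // => S S0 _ c _ _ x.
  by move=> /(S0 x) /=; rewrite in_fset0.
- by move=> a b Ha Hb; case: (leqP a b) => _.
- move=> Y /andP[]; rewrite fpowersetE => YX /asboolP gY.
  by exists Y.
Qed.

Lemma general_position_sub (X Y : set point) :
  (Y `<=` X)%classic -> general_position X -> general_position Y.
Proof. by move=> YX gX S SY; apply: gX => x /SY /YX. Qed.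

(** * Flats spanned by indexed points *)

Section Family.
Variable I : finType.
Implicit Types (x : I -> point) (J : {set I}).

(** Coefficients sit on indices, not on points, so equal points at two indices of [J] count as
    dependent; this later yields injectivity. *)
Definition affine_free x J : Prop :=
  forall c : I -> R, \sum_(i in J) c i = 0 ->
    \sum_(i in J) c i *: x i = 0 -> forall i, i \in J -> c i = 0.

Definition affine_hull x J (y : point) : Prop :=
  exists c : I -> R,
    \sum_(i in J) c i = 1 /\ \sum_(i in J) c i *: x i = y.

Lemma affine_hullS x J J' y :
  J \subset J' -> affine_hull x J y -> affine_hull x J' y.
Proof.
move=> /fintype.subsetP sJ [c [c1 cy]].
exists (fun i => if i \in J then c i else 0).
have E (V : zmodType) (f : I -> V) :
    \sum_(i in J') (if i \in J then f i else 0) = \sum_(i in J) f i.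
  rewrite -big_mkcondr; apply: eq_bigl => i.
  by apply/andP/idP => [[]|iJ] //; split => //; apply: sJ.
rewrite E c1; split=> //; rewrite -cy -E; apply: eq_bigr => i _.
by case: ifP => _; rewrite ?scale0r.
Qed.

(* A matrix expressing the points of [Z] by those of [J] has a nonzero left
   kernel when [Z] is larger, and its rows sum to 1: a kernel vector is an
   affine dependence of [Z]. *)
Lemma affinely_independent_card_le x J (Z : {fset point}) :
  affinely_independent Z -> (forall z, z \in Z -> affine_hull x J z) ->
  (#|` Z| <= #|J|)%N.
Proof.
move=> Zfree Zhull; rewrite leqNgt; apply/negP => ltJZ.
have /choice[C HC] : forall z, exists c : I -> R, z \in Z ->
    \sum_(i in J) c i = 1 /\ \sum_(i in J) c i *: x i = z.
  move=> z; have [/Zhull[c Hc]|] := boolP (z \in Z); first by exists c.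
  by exists (fun=> 0).
pose M := \matrix_(i < #|` Z|, j < #|J|) C (nth 0 Z i) (enum_val j).
have : kermx M != 0.
  rewrite kermx_eq0 -row_leq_rank -ltnNge.
  exact: leq_ltn_trans (rank_leq_col _) ltJZ.
case/rowV0Pn=> u /sub_kermxP uM /rV0Pn [i0].
pose c z := if insub (index z Z) is Some i then u 0 i else 0.
have cE (i : 'I_(#|` Z|)) : c (nth 0 Z i) = u 0 i.
  by rewrite /c index_uniq ?fset_uniq // valK.
have sumZ (V : zmodType) (F : point -> V) :
    \sum_(z <- Z) F z = \sum_(i < #|` Z|) F (nth 0 Z i).
  by rewrite (big_nth 0) big_mkord.
have Zi (i : 'I_(#|` Z|)) : nth 0 Z i \in Z by rewrite mem_nth.
have cJ j : j \in J -> \sum_(i < #|` Z|) u 0 i * C (nth 0 Z i) j = 0.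
  move=> jJ; have := congr1 (fun A : 'rV_(#|J|) => A 0 (enum_rank_in jJ j)) uM.
  rewrite !mxE => E; rewrite -[RHS]E; apply: eq_bigr => i _.
  by rewrite !mxE enum_rankK_in.
rewrite -cE Zfree ?eqxx // sumZ.
  under eq_bigr => i _ do rewrite cE -[u 0 i]mulr1 -(HC _ (Zi i)).1 mulr_sumr.
  by rewrite exchange_big big1 // => j /cJ.
under eq_bigr => i _.
  rewrite cE -[in X in _ *: X](HC _ (Zi i)).2 scaler_sumr.
  under eq_bigr do rewrite scalerA.
  over.
by rewrite exchange_big big1 // => j /cJ E; rewrite -scaler_suml E scale0r.
Qed.

Lemma general_position_card_hull x J (Y Z : {fset point}) :
  general_position [set` Y]%classic -> (#|J| <= d)%N -> Z `<=` Y ->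
  (forall z, z \in Z -> affine_hull x J z) -> (#|` Z| <= #|J|)%N.
Proof.
move=> gY Jd /fsubsetP ZY Zhull; rewrite leqNgt; apply/negP => ltJZ.
(* General position only controls sets of at most [d.+1] points, so [Z] is cut down to [#|J|.+1] of
   them, which is small enough since [#|J| <= d]. *)
pose W := [fset z in take #|J|.+1 Z].
have WZ z : z \in W -> z \in Z by rewrite !inE => /mem_take.
have cW : #|` W| = #|J|.+1.
  by rewrite card_fseq undup_id ?take_uniq ?fset_uniq // size_takel.
have := @affinely_independent_card_le x J W.
rewrite cW ltnn => /(_ _ _)/negP; apply; rewrite ?negbK //.
  by apply: gY; rewrite ?cW // => z /WZ /ZY.
by move=> z /WZ /Zhull.
Qed.

Lemma affine_free_extend x J i :
  i \notin J -> affine_free x J -> ~ affine_hull x J (x i) ->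
  affine_free x (i |: J).
Proof.
move=> iJ fJ nh c; rewrite !big_setU1 //= => c0 cx0.
(* A dependence with [c i != 0] could be solved for [x i], putting it in the hull. *)
have ci : c i = 0.
  apply/eqP/negPn/negP => ci; apply: nh; exists (fun j => - (c i)^-1 * c j).
  split; first by rewrite -mulr_sumr -(addr0_eq c0) mulrNN mulVf.
  under eq_bigr do rewrite -scalerA.
  by rewrite -scaler_sumr -(addr0_eq cx0) scalerN scaleNr opprK scalerA mulVf
    ?scale1r.
move=> j /setU1P[->//|]; apply: fJ.
  by rewrite ci add0r in c0.
by rewrite ci scale0r add0r in cx0.
Qed.

Lemma eq_affine_free x x' J :
  {in J, x =1 x'} -> affine_free x J -> affine_free x' J.
Proof.
move=> E fJ c c0 cx; apply: fJ => //; rewrite -[RHS]cx.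
by apply: eq_bigr => i /E ->.
Qed.

Lemma eq_affine_hull x x' J y :
  {in J, x =1 x'} -> affine_hull x J y -> affine_hull x' J y.
Proof.
move=> E [c [c1 cy]]; exists c; split=> //; rewrite -cy.
by apply: eq_bigr => i /E ->.
Qed.

(** * General position relative to a set of indices *)

Definition gp_on x (K : {set I}) : Prop :=
  forall J, J \subset K -> (#|J| <= d.+1)%N -> affine_free x J.

Lemma gp_on_extend x (K : {set I}) i (Y : {fset point}) :
  i \notin K -> gp_on x K -> general_position [set` Y]%classic ->
  (gpA d #|K|.+1 <= #|` Y|)%N ->
  exists2 y, y \in Y & gp_on (fun j => if j == i then y else x j) (i |: K).
Proof.
move=> iK gK gY; rewrite gpA_minn; set t := minn d #|K| => leY.
(* Avoiding the flats of exactly [t] indices suffices, as those of fewer indices of [K] lie in them;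
   this keeps the count at a single binomial. *)
have [y yY ny] : exists2 y, y \in Y &
    forall J, J \subset K -> #|J| = t -> ~ affine_hull x J y.
  apply: contrapT => noy.
  suff : (#|` Y| <= t * 'C(#|K|, t))%N by rewrite leqNgt leY.
  pose G J := [fset y in Y | `[< affine_hull x J y >]].
  apply: (@leq_trans
      (\sum_(J : {set I} | (J \subset K) && (#|J| == t)) #|` G J|)%N).
    apply: card_le_sum_cover => y yY; apply: contrapT => nJ.
    apply: noy; exists y => // J JK Jt hJ; apply: nJ; exists J.
      by rewrite JK Jt eqxx.
    by rewrite !inE yY; apply/asboolP.
  rewrite mulnC -cards_draws -sum_nat_const big_mkcond /= [leqRHS]big_mkcond /=.
  apply: leq_sum => J _; rewrite inE; case: ifP => // /andP[JK /eqP Jt].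
  rewrite -[leqRHS]Jt; apply: (general_position_card_hull gY (x := x)).
  - by rewrite Jt geq_minl.
  - by apply/fsubsetP => z; rewrite !inE => /andP[].
  - by move=> z; rewrite !inE => /andP[_ /asboolP].
exists y => //; set x' := fun j => _.
have xx' : {in K, x =1 x'}.
  by move=> j jK; rewrite /x'; case: eqVneq jK iK => // -> ->.
move=> J JK Jd; pose J0 := J :\ i.
have J0K : J0 \subset K.
  apply/fintype.subsetP => j; rewrite !inE => /andP[/negbTE ji].
  by move/(fintype.subsetP JK); rewrite !inE ji.
have xJ0 : {in J0, x =1 x'} by move=> j /(fintype.subsetP J0K) /xx'.
have fJ0 : affine_free x' J0.
  apply: eq_affine_free xJ0 _; apply: gK => //.
  exact: leq_trans (subset_leq_card (subD1set _ _)) Jd.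
have [iJ|iJ] := boolP (i \in J); last first.
  by have -> : J = J0 by apply/setP => j; rewrite !inE; case: eqVneq => // ->;
    apply/negbTE.
rewrite -(finset.setD1K iJ); apply: affine_free_extend => //; first by rewrite !inE eqxx.
have -> : x' i = y by rewrite /x' eqxx.
(* The bound by [d] holds because [J] has at most [d.+1] indices, one of them [i]. *)
have J0t : (#|J0| <= t)%N.
  rewrite leq_min subset_leq_card // andbT.
  by rewrite (cardsD1 i J) iJ in Jd.
(* Padding [J0] inside [K] to exactly [t] indices reaches a flat that [y] avoids. *)
have [|J1 [J01 J1K J1t]] := subset_card_between (n := t) J0K.
  by rewrite J0t geq_minr.
move=> h; apply: (ny J1) => //; apply: affine_hullS J01 _.
by apply: eq_affine_hull h => j /xJ0 ->.
Qed.

(** If two distinct indices had the same point, the weights 1 and -1 would be a dependence on two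
    indices, and [2 <= d.+1]. *)
Lemma gp_on_injective x : (1 <= d)%N -> gp_on x [set: I] -> injective x.
Proof.
move=> d1 gx i j xij; apply/eqP/negPn/negP => nij.
have/(_ _ _) f := gx [set i; j] (finset.subsetT _).
rewrite cards2 nij in f; have {}f := f d1 (fun k => if k == i then 1 else -1).
have ij : i \notin [set j] by rewrite inE.
move: f; rewrite !big_setU1 //= !big_set1 eqxx eq_sym (negbTE nij).
rewrite xij scale1r scaleN1r !subrr => /(_ erefl erefl i).
by rewrite !inE eqxx /= => /(_ isT) /eqP; rewrite oner_eq0.
Qed.

(** By injectivity each point of [S] comes from exactly one index, so dependences and cardinalities
    transfer from points to indices. *)
Lemma gp_on_general_position x :
  injective x -> gp_on x [set: I] -> general_position (range x).
Proof.
move=> xinj gx S Sx Sd c.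
pose J := [set i | x i \in S].
have pS : perm_eq S [seq x i | i in J].
  apply: uniq_perm; rewrite ?fset_uniq ?map_inj_uniq ?enum_uniq // => z.
  apply/idP/mapP => [zS|[i]]; last by rewrite mem_enum inE => ? ->.
  have [i _ xi] := Sx z zS; exists i => //.
  by rewrite mem_enum inE xi.
rewrite !(perm_big _ pS) !big_image /= => c0 cx z.
rewrite (perm_mem pS) => /mapP [i]; rewrite mem_enum => iJ ->.
have fJ : affine_free x J; last exact: (fJ (c \o x)).
apply: gx; first exact: finset.subsetT.
by rewrite (leq_trans _ Sd) // cardE -(size_map x) -(perm_size pS).
Qed.

End Family.
End GeneralPositionFamilies.

(** * Pigeonhole and induction on the family *)

Theorem theorem2p2 (R : realType) (d : nat) (hd : (1 <= d)%N) (m : nat)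
    (X : 'I_m -> {fset 'rV[R]_d})
    (hX : forall I : {set 'I_m}, I != finset.set0 ->
       (gpB d #|I| <= phi (\bigcup_(i in I) X i)%fset)%N) :
  has_gp_representatives X.
Proof.
(* Stated for every subfamily, so that one set can be removed at a time; the values of [x] outside
   [K] are unconstrained. *)
suff main (K : {set 'I_m}) : exists x : 'I_m -> 'rV[R]_d,
    (forall i, i \in K -> x i \in X i) /\ gp_on x K.
  have [x [xX gx]] := main [set: 'I_m].
  have xinj := gp_on_injective hd gx.
  by exists x; split=> // [i|]; [apply: xX; rewrite inE
    | apply: gp_on_general_position].
have [n] := ubnP #|K|; elim: n K => // n IH K; rewrite ltnS => Kn.
have [->|K0] := eqVneq K finset.set0.
  exists (fun=> 0); split=> [i|J]; first by rewrite inE.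
  by rewrite finset.subset0 => /eqP -> _ c _ _ i; rewrite inE.
have [Y [YX gY cY]] := phi_witness (\bigcup_(i in K) X i).
have [i iK Yi] : exists2 i, i \in K & (gpA d #|K| <= #|` Y `&` X i|)%N.
  (* If every [X i] held fewer than [gpA d #|K|] points of [Y], then [Y] would have at most
     [#|K| * (gpA d #|K|).-1] points, one less than [gpB d #|K|]. *)
  apply: contrapT => noi.
  have := hX K K0; rewrite -cY /gpB ltnNge => /negP; apply.
  rewrite -sum_nat_const.
  apply: (@leq_trans (\sum_(i in K) #|` Y `&` X i|)%N).
    apply: card_le_sum_cover => y yY.
    have /bigfcupP[i /andP[_ iK] yi] := fsubsetP YX y yY.
    by exists i => //; rewrite inE yY.
  apply: leq_sum => i iK; rewrite -ltnS.
  by apply: (@leq_trans (gpA d #|K|)); [rewrite ltnNge; apply/negP => ?;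
    apply: noi; exists i | exact: leqSpred].
(* The set found for the whole of [K] gets its representative last, once those for [K :\ i] are
   fixed. *)
have cK : #|K| = #|K :\ i|.+1 by rewrite (cardsD1 i) iK.
have [|x [xX gx]] := IH (K :\ i); first by rewrite -cK.
rewrite cK in Yi.
have [||y] := gp_on_extend (i := i) _ gx _ Yi; first by rewrite !inE eqxx.
  apply: general_position_sub gY => z /=; rewrite inE => /andP[] //.
rewrite inE => /andP[_ yX] gx'; exists (fun j => if j == i then y else x j).
rewrite finset.setD1K // in gx'; split=> // j jK.
by case: eqVneq => [->//|ji]; apply: xX; rewrite !inE ji.
Qed.
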